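(* Let $(\mathbf x_k,\mathbf z_k,\boldsymbol\lambda_k)_{k\ge 0}$, $\boldsymbol\lambda_k=[\boldsymbol\alpha_k;\boldsymbol\beta_k]$, be generated by the DQM recursion (see context) with constant $c>0$, and suppose the following hold. (1) Initialization: $\boldsymbol\alpha_0=-\boldsymbol\beta_0$, $\mathbf E_u\mathbf x_0=2\mathbf z_0$, and $\boldsymbol\alpha_0$ lies in the column space of $\mathbf E_o$. (2) Network: every singular value $\sigma(\mathbf E_u)$ of $\mathbf E_u$ satisfies $0<\gamma_u\le\sigma(\mathbf E_u)\le\Gamma_u$ for constants $\gamma_u,\Gamma_u$, and $\gamma_o>0$ is the smallest non-zero singular value of $\mathbf E_o$. (3) Each $f_i$ is twice differentiable and there are constants $0<m\le M<\infty$ with $m\mathbf I\preceq\nabla^2 f_i(\mathbf y)\preceq M\mathbf I$ for all $\mathbf y\in\mathbb R^p$ and all $i$. (4) There is a constant $L$ with $\|\nabla^2 f_i(\mathbf y)-\nabla^2 f_i(\hat{\mathbf y})\|\le L\|\mathbf y-\hat{\mathbf y}\|$ for all $\mathbf y,\hat{\mathbf y}\in\mathbb R^p$ and all $i$. Define the DQM error vector $$\mathbf e_k^{DQM}:=\nabla f(\mathbf x_k)+\mathbf H_k(\mathbf x_{k+1}-\mathbf x_k)-\nabla f(\mathbf x_{k+1}).$$ Then for all $k\ge 0$ $$\|\mathbf e_k^{DQM}\|\le\min\Big\{2M\|\mathbf x_{k+1}-\mathbf x_k\|,\;\tfrac L2\|\mathbf x_{k+1}-\mathbf x_k\|^2\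Big\}.$$
   Context: Network and matrices. Consider a connected network with node set $\mathcal V=\{1,\dots,n\}$ and a set $\mathcal E$ of $r$ ordered edges $(i,j)$, symmetric in the sense that $(i,j)\in\mathcal E$ iff $(j,i)\in\mathcal E$. The block source matrix $\mathbf A_s\in\mathbb R^{rp\times np}$ consists of $r\times n$ blocks of size $p\times p$, indexed by edges $e$ and nodes $i$: $(\mathbf A_s)_{e,i}=\mathbf I_p$ if $e=(i,j)\in\mathcal E$ for some $j$, and $\mathbf 0$ otherwise. The block destination matrix $\mathbf A_d\in\mathbb R^{rp\times np}$ has $(\mathbf A_d)_{e,i}=\mathbf I_p$ if $e=(j,i)\in\mathcal E$ for some $j$, and $\mathbf 0$ otherwise. Set $\mathbf A=[\mathbf A_s;\mathbf A_d]\in\mathbb R^{2rp\times np}$ and $\mathbf B=[-\mathbf I_{rp};-\mathbf I_{rp}]\in\mathbb R^{2rp\times rp}$ (semicolons denote vertical stacking), $\mathbf E_o=\mathbf A_s-\mathbf A_d$ (oriented incidence matrix), $\mathbf E_u=\mathbf A_s+\mathbf A_d$ (unoriented incidence matrix). Objective. $f_i:\mathbb R^p\to\mathbb R$ are the local costs; for $\mathbf x=[\mathbf x_1;\dots;\mathbf x_n]\in\mathbb R^{np}$, $f(\mathbf x)=\sum_{i=1}^n f_i(\mathbf x_i)$. DQM recursion with constant $c>0$: with $\mathbf H_k=\nabla^2 f(\mathbf x_k)$, $\mathbf z_k\in\mathbb R^{rp}$ and $\boldsymbol\lambda_k=[\boldsymbol\alpha_k;\boldsymbol\beta_k]$, $\boldsymbol\alpha_k,\boldsymbol\beta_k\in\mathbb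 R^{rp}$, for all $k\ge 0$ the iterates $\mathbf x_{k+1},\mathbf z_{k+1},\boldsymbol\lambda_{k+1}$ are determined by $$\nabla f(\mathbf x_k)+\mathbf H_k(\mathbf x_{k+1}-\mathbf x_k)+\mathbf A^T\boldsymbol\lambda_k+c\mathbf A^T(\mathbf A\mathbf x_{k+1}+\mathbf B\mathbf z_k)=\mathbf 0,$$ $$\mathbf B^T\boldsymbol\lambda_k+c\mathbf B^T(\mathbf A\mathbf x_{k+1}+\mathbf B\mathbf z_{k+1})=\mathbf 0,\qquad \boldsymbol\lambda_{k+1}-\boldsymbol\lambda_k-c(\mathbf A\mathbf x_{k+1}+\mathbf B\mathbf z_{k+1})=\mathbf 0.$$ Norms are Euclidean for vectors and spectral for matrices. *)

(* Defs.v *)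
From HB Require Import structures.
From mathcomp Require Import all_boot all_order all_algebra.
From mathcomp Require Import all_classical all_reals all_analysis.

Set Implicit Arguments.
Unset Strict Implicit.
Unset Printing Implicit Defensive.

Import Order.TTheory GRing.Theory Num.Theory.
Import numFieldNormedType.Exports.
Local Open Scope classical_set_scope.
Local Open Scope ring_scope.

Section LinearAlgebra.
Context {R : realType}.

(* The norm that the library puts on matrices is the max norm, so the
   Euclidean and spectral norms are defined here. *)
Definition enorm d (v : 'cV[R]_d) : R := Num.sqrt (\sum_(i < d) v i 0 ^+ 2).

Definition spectral_norm a b (A : 'M[R]_(a, b)) : R :=
  sup [set enorm (A *m v) | v in [set v : 'cV[R]_b | enorm v <= 1]].

(* This convention gives b singular values, counted with multiplicity: when
   a < b it includes the b - a extra zeros. *)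
Definition singular_value a b (A : 'M[R]_(a, b)) (s : R) : Prop :=
  0 <= s /\ eigenvalue (A^T *m A) (s ^+ 2).

(* The Loewner order.  Symmetry of B - A is not part of the definition; it is
   automatic for the Hessian of a twice differentiable function. *)
Definition loewner_le d (A B : 'M[R]_d) : Prop :=
  forall v : 'cV[R]_d, 0 <= (v^T *m (B - A) *m v) 0 0.

End LinearAlgebra.

Section Calculus.
Context {R : realType}.

Definition grad d (g : 'cV[R]_d -> R) (y : 'cV[R]_d) : 'cV[R]_d :=
  \col_(i < d) 'D_(delta_mx i 0) g y.

Definition hess d (g : 'cV[R]_d -> R) (y : 'cV[R]_d) : 'M[R]_d :=
  \matrix_(i < d, j < d) 'D_(delta_mx j 0) (fun w => grad g w i 0) y.

(* Frechet differentiability (the choice of norm is irrelevant here). *)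
Definition twice_differentiable d (g : 'cV[R]_d -> R) : Prop :=
  (forall y, differentiable g y) /\ (forall y, differentiable (grad g) y).

End Calculus.

(* R^{np}, seen as n stacked blocks of size p; the i-th block of x is
   [submxcol x i]. *)
Notation "''bV[' R ]_ ( n , p )" := 'cV[R]_(\sum_(i < n) p)
  (at level 0, only parsing) : type_scope.

Section Network.
Context {R : realType}.
Variables (n p : nat) (E : {set 'I_n * 'I_n}).

(* The rows are indexed by the ordered edges, enumerated by [enum_val]. *)
Definition block_source : 'M[R]_(\sum_(e < #|E|) p, \sum_(i < n) p) :=
  \mxblock_(e < #|E|, i < n)
    (if (enum_val e).1 == i then 1%:M else 0 : 'M[R]_p).

Definition block_destination : 'M[R]_(\sum_(e < #|E|) p, \sum_(i < n) p) :=
  \mxblock_(e < #|E|, i < n)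
    (if (enum_val e).2 == i then 1%:M else 0 : 'M[R]_p).

Definition mxA := col_mx block_source block_destination.

Definition mxB : 'M[R]_(\sum_(e < #|E|) p + \sum_(e < #|E|) p,
                        \sum_(e < #|E|) p) :=
  col_mx (- 1%:M) (- 1%:M).

Definition oriented_incidence := block_source - block_destination.

Definition unoriented_incidence := block_source + block_destination.

Definition aggregate (f : 'I_n -> 'cV[R]_p -> R) (x : 'bV[R]_(n, p)) : R :=
  \sum_(i < n) f i (submxcol x i).

Definition dqm_recursion (f : 'I_n -> 'cV[R]_p -> R) (c : R)
    (x : nat -> 'bV[R]_(n, p))
    (z alpha beta : nat -> 'bV[R]_(#|E|, p)) : Prop :=
  let F := aggregate f in
  let lambda k := col_mx (alpha k) (beta k) in
  forall k,
  [/\ grad F (x k) + hess F (x k) *m (x k.+1 - x k) + mxA^T *m lambda k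
        + c *: (mxA^T *m (mxA *m x k.+1 + mxB *m z k)) = 0,
      mxB^T *m lambda k
        + c *: (mxB^T *m (mxA *m x k.+1 + mxB *m z k.+1)) = 0
    & lambda k.+1 - lambda k
        - c *: (mxA *m x k.+1 + mxB *m z k.+1) = 0].

Definition dqm_error (f : 'I_n -> 'cV[R]_p -> R)
    (x : nat -> 'bV[R]_(n, p)) (k : nat) : 'bV[R]_(n, p) :=
  let F := aggregate f in
  grad F (x k) + hess F (x k) *m (x k.+1 - x k) - grad F (x k.+1).

End Network.

(* Main.v *)
Require Import Defs.
From HB Require Import structures.
From mathcomp Require Import all_boot all_order all_algebra.
From mathcomp Require Import all_classical all_reals all_analysis.
From mathcomp Require Import ring lra.

(* The gradient and the Hessian of the aggregate cost split into blocks, so it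
   suffices to bound the linearization error e of the gradient of a single f_i
   from y to y + v, and then to sum squares.  Applying the mean value theorem
   to s |-> <e, grad f_i(y) + s H(y) v - grad f_i(y + s v)> (minus a quadratic
   in s) bounds |e|^2 by means of <e, (H(y) - H(y + s v)) v>.  The Lipschitz
   bound on H gives L/2 |v|^2.  For the other bound, H(y) - H(y + s v) lies
   between -M I and M I in the Loewner order; since Hessians are symmetric,
   which follows from twice Frechet differentiability, its spectral norm is at
   most M. *)

Set Implicit Arguments.
Unset Strict Implicit.
Unset Printing Implicit Defensive.

Import Order.TTheory GRing.Theory Num.Theory.
Import numFieldNormedType.Exports.
Local Open Scope ring_scope.

(** * Euclidean inner product and the spectral norm *)

Section Euclidean.
Context {R : realType}.

Definition dot d (u v : 'cV[R]_d) : R := (u^T *m v) 0 0.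

Lemma dotE d (u v : 'cV[R]_d) : dot u v = \sum_i u i 0 * v i 0.
Proof. by rewrite /dot mxE; apply: eq_bigr => i _; rewrite mxE. Qed.

Lemma dotC d (u v : 'cV[R]_d) : dot u v = dot v u.
Proof. by rewrite !dotE; apply: eq_bigr => i _; rewrite mulrC. Qed.

Lemma dotDr d (u v w : 'cV[R]_d) : dot u (v + w) = dot u v + dot u w.
Proof. by rewrite /dot mulmxDr mxE. Qed.

Lemma dotZr d a (u v : 'cV[R]_d) : dot u (a *: v) = a * dot u v.
Proof. by rewrite /dot -scalemxAr mxE. Qed.

Lemma dotNr d (u v : 'cV[R]_d) : dot u (- v) = - dot u v.
Proof. by rewrite -scaleN1r dotZr mulN1r. Qed.

Lemma dotDl d (u v w : 'cV[R]_d) : dot (u + v) w = dot u w + dot v w.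
Proof. by rewrite dotC dotDr !(dotC w). Qed.

Lemma dotZl d a (u v : 'cV[R]_d) : dot (a *: u) v = a * dot u v.
Proof. by rewrite dotC dotZr dotC. Qed.

Lemma dotNl d (u v : 'cV[R]_d) : dot (- u) v = - dot u v.
Proof. by rewrite dotC dotNr dotC. Qed.

Definition dot_linE := (dotDl, dotDr, dotNl, dotNr, dotZl, dotZr).

Lemma dot_symmx d (S : 'M[R]_d) (u v : 'cV[R]_d) :
  S^T = S -> dot u (S *m v) = dot v (S *m u).
Proof. by move=> Ssym; rewrite dotC /dot trmx_mul Ssym mulmxA. Qed.

Lemma dotvv_ge0 d (v : 'cV[R]_d) : 0 <= dot v v.
Proof. by rewrite dotE sumr_ge0 // => i _; rewrite -expr2 sqr_ge0. Qed.

Lemma enorm_ge0 d (v : 'cV[R]_d) : 0 <= enorm v.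
Proof. exact: sqrtr_ge0. Qed.

Lemma sqr_enorm d (v : 'cV[R]_d) : enorm v ^+ 2 = dot v v.
Proof.
rewrite dotE sqr_sqrtr; first by apply: eq_bigr => i _; rewrite expr2.
by apply: sumr_ge0 => i _; rewrite sqr_ge0.
Qed.

Lemma enorm_eq0 d (v : 'cV[R]_d) : enorm v = 0 -> v = 0.
Proof.
move=> v0; have := sqr_enorm v; rewrite v0 expr0n /= dotE => /esym/eqP.
rewrite psumr_eq0 => [/allP vi0|i _]; last by rewrite -expr2 sqr_ge0.
apply/matrixP => i j; rewrite (ord1 j) mxE.
by have := vi0 i (mem_index_enum i); rewrite mulf_eq0 orbb => /eqP.
Qed.

(** Cancels one factor of the norm, so that a linear estimate of <e, e> bounds |e|; if the norm is
    zero, only 0 <= B remains. *)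
Lemma enorm_le d (v : 'cV[R]_d) (B : R) :
  0 <= B -> dot v v <= B * enorm v -> enorm v <= B.
Proof.
move=> B0; have := enorm_ge0 v; rewrite le_eqVlt => /predU1P[<-//|v0].
by rewrite -sqr_enorm expr2 ler_pM2r.
Qed.

(* Polarization, applied to vectors rescaled to have the same norm. *)
Lemma symmx_form_le d (S : 'M[R]_d) (K : R) (u v : 'cV[R]_d) :
    S^T = S -> (forall w, `|dot w (S *m w)| <= K * dot w w) ->
  dot u (S *m v) <= K * (enorm u * enorm v).
Proof.
move=> Ssym SK; set a := enorm u; set b := enorm v.
have [a0|a0] := eqVneq a 0.
  by rewrite a0 (enorm_eq0 a0) mul0r mulr0 /dot trmx0 mul0mx mxE.
have [b0|b0] := eqVneq b 0.
  by rewrite b0 (enorm_eq0 b0) !mulr0 /dot !mulmx0 mxE.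
have ab0 : 0 < a * b by rewrite mulr_gt0 // lt_def ?a0 ?b0 enorm_ge0.
rewrite -(ler_pM2l ab0).
(* The forms at b u + a v and b u - a v differ by 4ab <u, S v>, while the sum of their bounds is 4 K
   a^2 b^2. *)
have := lerB (le_trans (ler_norm _) (SK (b *: u + a *: v)))
  (lerNnormlW (SK (b *: u - a *: v))).
rewrite !mulmxDr !mulmxN -!scalemxAr !dot_linE.
rewrite (dot_symmx v u Ssym) (dotC v u) -!sqr_enorm -/a -/b; nra.
Qed.

Lemma cauchy_schwarz d (u v : 'cV[R]_d) : dot u v <= enorm u * enorm v.
Proof.
rewrite -[X in dot u X]mul1mx -[leRHS]mul1r.
apply: symmx_form_le => [|w]; first exact: trmx1.
by rewrite mul1mx mul1r ger0_norm // dotvv_ge0.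
Qed.

Lemma enormN d (v : 'cV[R]_d) : enorm (- v) = enorm v.
Proof. by congr Num.sqrt; apply: eq_bigr => i _; rewrite mxE sqrrN. Qed.

Lemma enormZ d a (v : 'cV[R]_d) : enorm (a *: v) = `|a| * enorm v.
Proof.
rewrite /enorm -sqrtr_sqr -sqrtrM ?sqr_ge0 // mulr_sumr.
by congr Num.sqrt; apply: eq_bigr => i _; rewrite mxE exprMn.
Qed.

(** Cauchy-Schwarz row by row gives the Frobenius norm as an upper bound. It makes the set in
    [spectral_norm] bounded above, without which its [sup] need not dominate its elements. *)
Lemma enorm_mulmx_le a b (A : 'M[R]_(a, b)) (v : 'cV[R]_b) :
  enorm v <= 1 -> enorm (A *m v) <= Num.sqrt (\sum_i enorm (row i A)^T ^+ 2).
Proof.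
move=> v1; apply: ler_wsqrtr; apply: ler_sum => i _.
have -> : (A *m v) i 0 = dot (row i A)^T v.
  by rewrite /dot trmxK -row_mul [RHS]mxE.
rewrite -[leLHS]real_normK ?num_real // ler_sqr ?nnegrE ?enorm_ge0 //.
rewrite -[leRHS]mulr1; apply: le_trans (ler_wpM2l (enorm_ge0 _) v1).
rewrite ler_norml cauchy_schwarz andbT lerNl -dotNr.
by rewrite -(enormN v) cauchy_schwarz.
Qed.

Lemma enorm_mulmx a b (A : 'M[R]_(a, b)) (v : 'cV[R]_b) :
  enorm (A *m v) <= spectral_norm A * enorm v.
Proof.
have [v0|v0] := eqVneq (enorm v) 0.
  rewrite (enorm_eq0 v0) mulmx0 -(scale0r (0 : 'cV_a)) enormZ.
  by rewrite -(scale0r (0 : 'cV_b)) enormZ normr0 !mul0r mulr0.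
have vgt0 : 0 < enorm v by rewrite lt_def v0 enorm_ge0.
rewrite -ler_pdivrMr // mulrC.
have -> : (enorm v)^-1 * enorm (A *m v) = enorm (A *m ((enorm v)^-1 *: v)).
  by rewrite -scalemxAr enormZ gtr0_norm // invr_gt0.
apply: ub_le_sup.
  by eexists => _ [w /= w1 <-]; exact: enorm_mulmx_le.
exists ((enorm v)^-1 *: v) => //=.
by rewrite enormZ gtr0_norm ?invr_gt0 // mulVf.
Qed.

End Euclidean.

(** * Directional derivatives and symmetry of mixed ones *)

Section DirectionalDerivatives.
Context {R : realType}.

(** The two difference quotients are the same function of the increment, so derivability in the
    direction [d] suffices and no chain rule is involved. *)
Lemma is_derive_line (V W : normedModType R) (g : V -> W) (y d : V) (s : R) :
  derivable g (y + s *: d) d ->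
  is_derive s (1 : R) (fun t : R => g (y + t *: d)) ('D_d g (y + s *: d)).
Proof.
have eq_quot : (fun h : R => h^-1 *: (((fun t : R => g (y + t *: d)) \o shift s)
      (h *: 1) - g (y + s *: d))) =
    (fun h => h^-1 *: ((g \o shift (y + s *: d)) (h *: d) - g (y + s *: d))).
  apply/funext => h /=; congr (_ *: (g _ - _)).
  by rewrite [h *: 1]mulr1 scalerDl addrCA.
by move=> gd; split; rewrite /derivable /derive eq_quot.
Qed.

Lemma derive_shift (V W : normedModType R) (g : V -> W) (y u w : V) :
  'D_u (fun z => g (z + w)) y = 'D_u g (y + w).
Proof.
rewrite /derive; set q := fun h : R => _.
have -> // : q = fun h => h^-1 *: ((g \o shift (y + w)) (h *: u) - g (y + w)).
by apply/funext => h; rewrite /q /= addrA.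
Qed.

Lemma MVT_line (V : normedModType R) (g : V -> R) (y d : V) (a : R) :
  (forall z, differentiable g z) -> 0 < a ->
  exists2 s, 0 < s < a & g (y + a *: d) - g y = a * 'D_d g (y + s *: d).
Proof.
move=> gd a0.
have gline s : is_derive s (1 : R) (fun t : R => g (y + t *: d))
    ('D_d g (y + s *: d)).
  by apply: is_derive_line; exact: diff_derivable.
have gcont : {within `[0, a], continuous (fun t : R => g (y + t *: d))}%classic.
  by apply: derivable_within_continuous => s _; case: (gline s).
have [s] := MVT a0 (fun s _ => gline s) gcont.
rewrite in_itv /= scale0r addr0 subr0 => s0a ->.
by exists s => //; rewrite mulrC.
Qed.

Lemma differentiable_expansion (V : normedModType R) (g : V -> R) (y : V)
    (e : R) : differentiable g y -> 0 < e ->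
  exists2 r, 0 < r & forall h, `|h| < r ->
    `|g (y + h) - g y - 'D_h g y| <= e * `|h|.
Proof.
move=> gd e0; have := diff_locally gd; move/eqaddoP => /(_ e e0).
move=> /nbhs_ballP[r r0 gr]; exists r => // h hr.
rewrite deriveE // [y + h]addrC -addrA -opprD.
by apply: gr => //; rewrite -ball_normE /= sub0r normrN.
Qed.

(* Two mean value steps: the difference in direction [u] produces the factor
   [t], the first-order expansion of ['D_u g] at [y] the rest. *)
Lemma second_difference (V : normedModType R) (g : V -> R) (y u v : V) (e : R) :
    (forall z, differentiable g z) -> differentiable ('D_u g) y -> 0 < e ->
  exists2 r, 0 < r & forall t, 0 < t < r ->
    `|g (y + t *: u + t *: v) - g (y + t *: u) - g (y + t *: v) + g y
        - t ^+ 2 * 'D_v ('D_u g) y| <= e * t ^+ 2.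
Proof.
move=> gd Dgd e0.
(* [C] dominates |u| and |u| + |v|, which keeps both evaluation points in the ball of radius [r],
   and also 2|u| + |v|, the total of the two expansion errors divided by t. The 1 makes it
   positive. *)
pose C := 2 * `|u| + `|v| + 1.
have C0 : 0 < C by rewrite ltr_pwDr // addr_ge0 // mulr_ge0.
have [r r0 gr] := differentiable_expansion Dgd (divr_gt0 e0 C0).
exists (r / C); first exact: divr_gt0.
move=> t /andP[t0]; rewrite ltr_pdivlMr // => tr.
(* The second difference is the increment of [k] from y to y + t u. *)
pose k z := g (z + t *: v) - g z.
have kd z : differentiable k z.
  apply: differentiableB => //.
  by apply: (@differentiable_comp _ _ _ _ (fun z => z + t *: v) g) => //.
have [s /andP[s0 st]] := MVT_line y u kd t0.
have -> : 'D_u k (y + s *: u) =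
    'D_u g (y + (s *: u + t *: v)) - 'D_u g (y + s *: u).
  rewrite addrA deriveB //; last by apply: diff_derivable.
    by rewrite derive_shift.
  apply: diff_derivable.
  by apply: (@differentiable_comp _ _ _ _ (fun z => z + t *: v) g).
rewrite /k => kE.
have su_le : `|s *: u| <= t * `|u|.
  by rewrite normrZ gtr0_norm // ler_wpM2r // ltW.
have suv_le : `|s *: u + t *: v| <= t * (`|u| + `|v|).
  by rewrite (le_trans (ler_normD _ _)) // mulrDr lerD // normrZ gtr0_norm.
have D1 : 'D_(s *: u + t *: v) ('D_u g) y =
    s * 'D_u ('D_u g) y + t * 'D_v ('D_u g) y.
  by rewrite !deriveE // linearD !linearZ.
have D2 : 'D_(s *: u) ('D_u g) y = s * 'D_u ('D_u g) y.
  by rewrite !deriveE // linearZ.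
have uC : `|u| <= C by move: (normr_ge0 u) (normr_ge0 v); rewrite /C; clear; lra.
have uvC : `|u| + `|v| <= C by move: (normr_ge0 u); rewrite /C; clear; lra.
have tC (w : V) (B : R) : `|w| <= t * B -> B <= C -> `|w| < r.
  move=> wB BC; apply: le_lt_trans wB _; apply: le_lt_trans tr.
  by rewrite ler_wpM2l // ltW.
have := gr _ (tC _ _ suv_le uvC); have := gr _ (tC _ _ su_le uC).
rewrite D1 D2.
set G0 := 'D_u g y; set G1 := 'D_u g (y + s *: u).
set G2 := 'D_u g (y + _); set Duu := 'D_u _ y; set Duv := 'D_v _ y.
move=> h1 h2.
have -> : g (y + t *: u + t *: v) - g (y + t *: u) - g (y + t *: v) + g y =
    t * (G2 - G1) by rewrite -kE; ring.
(* Subtracting the expansions at s u + t v and at s u cancels the terms in s, where s is the unknown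
   mean value point. *)
have -> : t * (G2 - G1) - t ^+ 2 * Duv =
    t * ((G2 - G0 - (s * Duu + t * Duv)) - (G1 - G0 - s * Duu)) by ring.
rewrite normrM gtr0_norm // expr2 mulrCA ler_pM2l //.
apply: le_trans (ler_normB _ _) _; apply: le_trans (lerD h2 h1) _.
rewrite -mulrDr mulrAC ler_pdivrMr // -mulrA ler_pM2l //.
apply: le_trans (lerD suv_le su_le) _; rewrite -mulrDr ler_pM2l //.
by rewrite /C; clear; lra.
Qed.

(** The second difference is symmetric in u and v, and for small t it lies within (e/2) t^2 of t^2
    times either mixed derivative; divide by t^2 and let e tend to 0. *)
Lemma derive_comm (V : normedModType R) (g : V -> R) (y u v : V) :
    (forall z, differentiable g z) ->
    differentiable ('D_u g) y -> differentiable ('D_v g) y ->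
  'D_v ('D_u g) y = 'D_u ('D_v g) y.
Proof.
move=> gd Du Dv; apply/eqP; rewrite -subr_eq0 -normr_le0.
apply/ler_addgt0Pl => e e0; rewrite addr0.
have e20 : 0 < e / 2 by rewrite divr_gt0.
have [r r0 hr] := second_difference v gd Du e20.
have [r' r'0 hr'] := second_difference u gd Dv e20.
pose t := Num.min r r' / 2.
have m0 : 0 < Num.min r r' by rewrite lt_min r0.
have t0 : 0 < t by rewrite divr_gt0.
have tm : t < Num.min r r' by rewrite /t; lra.
move: tm; rewrite lt_min => /andP[tr tr'].
have t20 : 0 < t ^+ 2 by rewrite exprn_gt0.
have := hr t; rewrite t0 tr => /(_ isT) h1.
have := hr' t; rewrite t0 tr' => /(_ isT).
rewrite -[y + t *: v + t *: u]addrA [t *: v + _]addrC addrA => h2.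
rewrite -(ler_pM2l t20) -[t ^+ 2 in leLHS]gtr0_norm // -normrM mulrBr.
set D := g (y + _ + _) - g (y + t *: u) - _ + _ in h1.
rewrite (_ : _ - _ - _ + _ = D) in h2; last by rewrite /D; ring.
apply: le_trans (ler_distD D _ _) _; rewrite [e]splitr mulrDr.
rewrite [t ^+ 2 * (e / 2)]mulrC distrC.
exact: lerD h1 h2.
Qed.

End DirectionalDerivatives.

(** * Symmetry of the Hessian and the gradient remainder *)

Section GradientAndHessian.
Context {R : realType}.

Lemma derive_grad d (g : 'cV[R]_d -> R) (y v : 'cV[R]_d) :
  differentiable g y -> 'D_v g y = dot v (grad g y).
Proof.
move=> gd; rewrite dotE deriveE //.
rewrite [v in LHS]matrix_sum_delta (linear_sum ('d g y)) /=.
apply: eq_bigr => i _; rewrite big_ord1 linearZ /= mxE deriveE //.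
Qed.

Lemma differentiable_gradi d (g : 'cV[R]_d -> R) (y : 'cV[R]_d) i :
  differentiable (grad g) y -> differentiable (fun w => grad g w i 0) y.
Proof.
move=> gd; apply: (@differentiable_comp _ _ _ _ (grad g)
  (fun M : 'cV[R]_d => M i 0)) => //.
exact: differentiable_coord.
Qed.

Lemma derive_gradi d (g : 'cV[R]_d -> R) (y v : 'cV[R]_d) i :
  differentiable (grad g) y ->
  'D_v (fun w => grad g w i 0) y = (hess g y *m v) i 0.
Proof.
move=> gd; rewrite derive_grad; last exact: differentiable_gradi.
rewrite dotC dotE mxE; apply: eq_bigr => j _; congr (_ * _).
by rewrite !mxE.
Qed.

Lemma hess_sym d (g : 'cV[R]_d -> R) (y : 'cV[R]_d) :
  twice_differentiable g -> (hess g y)^T = hess g y.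
Proof.
move=> [gd ggd]; apply/matrixP => i j; rewrite !mxE.
have gradE k : (fun w => grad g w k 0) = 'D_(delta_mx k 0) g.
  by apply/funext => w; rewrite mxE.
have := differentiable_gradi i (ggd y); have := differentiable_gradi j (ggd y).
by rewrite !gradE => gj gi; rewrite derive_comm.
Qed.

(** The mean value theorem stands in for integrating a + b s over [0, 1]. An affine bound covers
    both later uses: b = 0 for the linear estimate, a = 0 for the quadratic one. *)
Lemma gradient_remainder_le d (g : 'cV[R]_d -> R) (y v w : 'cV[R]_d) (a b : R) :
    (forall z, differentiable (grad g) z) ->
    (forall s, 0 < s < 1 ->
       dot w ((hess g y - hess g (y + s *: v)) *m v) <= a + b * s) ->
  dot w (grad g y + hess g y *m v - grad g (y + v)) <= a + b / 2.
Proof.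
move=> ggd bound.
pose q := dot w (grad g y).
pose r := dot w (hess g y *m v).
have dw s : is_derive s (1 : R) (fun s : R => dot w (grad g (y + s *: v)))
    (dot w (hess g (y + s *: v) *m v)).
  have -> : (fun s : R => dot w (grad g (y + s *: v))) =
      \sum_i (w i 0 \*: (fun s : R => grad g (y + s *: v) i 0)).
    by apply/funext => t; rewrite dotE fct_sumE.
  rewrite dotE; apply: is_derive_sum => i; apply: is_deriveZ.
  rewrite -(derive_gradi v i (ggd (y + s *: v))).
  apply: (@is_derive_line _ _ _ (fun z => grad g z i 0)).
  by apply: diff_derivable; apply: differentiable_gradi.
pose D s := dot w (grad g (y + s *: v)).
(* By the assumed bound the derivative of [h] is at most 0 on (0, 1), and h 1 <= h 0 is the claim
   rearranged. *)
pose h : R -> R := (r - a) \*: id - D - (b / 2) \*: id ^+ 2.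
have dh s : is_derive s (1 : R) h
    (r - a - dot w (hess g (y + s *: v) *m v) - b * s).
  have d1 := is_deriveB (is_deriveZ (r - a) (is_derive_id s (1 : R))) (dw s).
  have d2 := is_deriveZ (b / 2) (is_deriveX 2 (is_derive_id s (1 : R))).
  apply: is_derive_eq (is_deriveB d1 d2) _.
  rewrite [(r - a)%:A]mulr1; congr (_ - _).
  by rewrite [(_ * _)%:A]mulr1 /= expr1 [LHS]mulrA divfK.
have hcont : {within `[0, 1], continuous h}%classic.
  by apply: derivable_within_continuous => s _; case: (dh s).
have [s] := MVT ltr01 (fun s _ => dh s) hcont.
rewrite in_itv /= subr0 mulr1 => s01 hs.
have rs := bound s s01; rewrite mulmxBl dotDr dotNr in rs.
have h10 : h 1 <= h 0.
  by rewrite -subr_le0 hs subr_le0 lerBlDr lerBlDl addrA -lerBlDr.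
have -> : dot w (grad g y + hess g y *m v - grad g (y + v)) = q + r - D 1.
  by rewrite /D scale1r 2!dotDr dotNr.
have D0 : D 0 = q by rewrite /D scale0r addr0.
have hE t : h t = (r - a) * t - D t - b / 2 * t ^+ 2 by [].
move: h10; rewrite !hE D0; clear.
by move: (D 1) r q => D1 r q; lra.
Qed.

End GradientAndHessian.

(** * The two error bounds for a single cost *)

Section LinearizationError.
Context {R : realType}.

Definition linearization_error d (g : 'cV[R]_d -> R) (y v : 'cV[R]_d) :=
  grad g y + hess g y *m v - grad g (y + v).

Lemma loewner_leP d (A B : 'M[R]_d) :
  loewner_le A B <-> forall v, dot v (A *m v) <= dot v (B *m v).
Proof.
by split=> AB v; have := AB v;
  rewrite -mulmxA -/(dot _ _) mulmxBl dotDr dotNr subr_ge0.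
Qed.

Lemma linearization_error_bounded d (g : 'cV[R]_d -> R) (m M : R)
    (y v : 'cV[R]_d) :
    0 <= m -> twice_differentiable g ->
    (forall z, loewner_le m%:M (hess g z) /\ loewner_le (hess g z) M%:M) ->
  enorm (linearization_error g y v) <= M * enorm v.
Proof.
(* Two numbers in [0, K] differ by at most K, which gives the constant M instead of 2M. *)
have dist_le (a b K : R) : 0 <= a <= K -> 0 <= b <= K -> `|a - b| <= K.
  by rewrite ler_norml => /andP[? ?] /andP[? ?]; apply/andP; split; lra.
move=> m0 g2 gmM; set e := linearization_error g y v.
have gquad z u : 0 <= dot u (hess g z *m u) <= M * dot u u.
  have [/loewner_leP/(_ u) + /loewner_leP/(_ u)] := gmM z.
  rewrite !mul_scalar_mx !dotZr => h ->; rewrite andbT; apply: le_trans h.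
  by rewrite mulr_ge0 // dotvv_ge0.
have diff_quad z z' u : `|dot u ((hess g z - hess g z') *m u)| <= M * dot u u.
  by rewrite mulmxBl dotDr dotNr; apply: dist_le.
(* The sign of M is not assumed: for nonzero v it follows from 0 <= <v, H v> <= M |v|^2. *)
have Mv0 : 0 <= M * enorm v.
  have [->|v0] := eqVneq (enorm v) 0; first by rewrite mulr0.
  have v_gt0 : 0 < enorm v by rewrite lt_def v0 enorm_ge0.
  rewrite -(pmulr_lge0 _ v_gt0) -mulrA -expr2 sqr_enorm.
  by have /andP[/le_trans] := gquad y v; apply.
apply: enorm_le => //.
(* Prepares a = M |v| |e| and b = 0. *)
rewrite -[leRHS]addr0 -[X in _ + X](mul0r 2^-1).
apply: gradient_remainder_le => [|s _]; first by case: g2.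
rewrite mul0r addr0 -mulrA [enorm v * _]mulrC.
apply: symmx_form_le => [|w]; last exact: diff_quad.
by rewrite linearB; congr (_ - _); exact: hess_sym.
Qed.

Lemma linearization_error_lipschitz d (g : 'cV[R]_d -> R) (L : R)
    (y v : 'cV[R]_d) :
    twice_differentiable g ->
    (forall z z', spectral_norm (hess g z - hess g z') <= L * enorm (z - z')) ->
  enorm (linearization_error g y v) <= L / 2 * enorm v ^+ 2.
Proof.
move=> [_ ggd] gL; set e := linearization_error g y v.
have Lv s : 0 <= s ->
    enorm ((hess g y - hess g (y + s *: v)) *m v) <= L * enorm v ^+ 2 * s.
  move=> s0; apply: le_trans (enorm_mulmx _ _) _.
  apply: le_trans (ler_wpM2r (enorm_ge0 _) (gL _ _)) _.
  rewrite opprD addNKr enormN enormZ ger0_norm //.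
  by rewrite expr2 le_eqVlt; apply/orP; left; apply/eqP; ring.
apply: enorm_le.
  (* L has no assumed sign; L |v|^2 bounds a norm when s = 1, hence is nonnegative. *)
  have := le_trans (enorm_ge0 _) (Lv 1 ler01); rewrite mulr1 => Lv0.
  by rewrite mulrAC divr_ge0.
have -> : L / 2 * enorm v ^+ 2 * enorm e =
    0 + (L * enorm v ^+ 2 * enorm e) / 2 by ring.
apply: gradient_remainder_le => // s /andP[/ltW s0 _].
apply: le_trans (cauchy_schwarz _ _) _.
rewrite add0r mulrAC [leRHS]mulrC; apply: ler_wpM2l; first exact: enorm_ge0.
exact: Lv.
Qed.

End LinearizationError.

(** * Block decomposition of the aggregate cost *)

Section BlockVectors.
Context {R : realType}.
Variables (n p : nat).

Lemma dot_blocks (u v : 'bV[R]_(n, p)) :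
  dot u v = \sum_(i < n) dot (submxcol u i) (submxcol v i).
Proof.
rewrite -{1}[u]submxcolK -{1}[v]submxcolK /dot tr_mxcol mul_mxrow_mxcol.
by rewrite summxE.
Qed.

(** Taking a block is linear, so the difference quotients coincide, as for lines. *)
Lemma is_derive_block (i : 'I_n) (W : normedModType R) (g : 'cV[R]_p -> W)
    (x v : 'bV[R]_(n, p)) :
  differentiable g (submxcol x i) ->
  is_derive x v (fun w : 'bV[R]_(n, p) => g (submxcol w i))
    ('D_(submxcol v i) g (submxcol x i)).
Proof.
have eq_quot : (fun h : R => h^-1 *: (((fun w : 'bV[R]_(n, p) =>
      g (submxcol w i)) \o shift x) (h *: v) - g (submxcol x i))) =
    (fun h => h^-1 *: ((g \o shift (submxcol x i)) (h *: submxcol v i)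
      - g (submxcol x i))).
  apply/funext => h /=; congr (_ *: (g _ - _)).
  by apply/matrixP => a b; rewrite !mxE.
by move=> /diff_derivable gd; split; rewrite /derivable /derive eq_quot //; exact: gd.
Qed.

Lemma dot_delta d (k : 'I_d) (u : 'cV[R]_d) : dot (delta_mx k 0) u = u k 0.
Proof. by rewrite /dot trmx_delta -rowE mxE. Qed.

Lemma grad_aggregate (f : 'I_n -> 'cV[R]_p -> R) (x : 'bV[R]_(n, p)) :
    (forall i z, differentiable (f i) z) ->
  grad (aggregate f) x = \mxcol_i grad (f i) (submxcol x i).
Proof.
(* Writing coordinate k as a product with a basis vector lets [dot_blocks] recombine the block
   derivatives without locating k in a block. *)
move=> fd; apply/matrixP => k b; rewrite (ord1 b) mxE -[RHS]dot_delta.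
have -> : aggregate f = \sum_i (fun w : 'bV[R]_(n, p) => f i (submxcol w i)).
  by apply/funext => w; rewrite fct_sumE.
have dF i := is_derive_block (delta_mx k 0) (fd i (submxcol x i)).
rewrite (@derive_val _ _ _ _ _ _ _ (is_derive_sum dF)) dot_blocks.
by apply: eq_bigr => i _; rewrite mxcolK derive_grad.
Qed.

Lemma hess_aggregate (f : 'I_n -> 'cV[R]_p -> R) (x : 'bV[R]_(n, p)) :
    (forall i, twice_differentiable (f i)) ->
  hess (aggregate f) x = \mxdiag_i hess (f i) (submxcol x i).
Proof.
move=> f2; apply/matrixP => k l.
set H := \mxdiag_i _.
(* As column l is H applied to a basis vector, the zero off-diagonal blocks need no case split:
   block i of that vector vanishes when l lies elsewhere. *)
have -> : H k l = (H *m delta_mx l (0 : 'I_1)) k 0 by rewrite -colE [RHS]mxE.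
rewrite -[delta_mx l _]submxcolK /H mul_mxdiag_mxcol !mxE.
(* [i] is the block containing k and [j] the position of k inside it. *)
set i := tagnat.sig1 k; set j := tagnat.sig2 k.
have -> : (fun w => grad (aggregate f) w k 0) =
    (fun w : 'bV[R]_(n, p) => (fun z => grad (f i) z j 0) (submxcol w i)).
  by apply/funext => w; rewrite grad_aggregate ?mxE // => a z; case: (f2 a).
have [_ ggd] := f2 i.
have gj := differentiable_gradi j (ggd (submxcol x i)).
have := is_derive_block (delta_mx l 0) gj.
by move/@derive_val => ->; rewrite derive_gradi // mxE.
Qed.

Lemma dqm_error_blocks (f : 'I_n -> 'cV[R]_p -> R)
    (x : nat -> 'bV[R]_(n, p)) (k : nat) :
    (forall i, twice_differentiable (f i)) ->
  dqm_error f x k = \mxcol_i linearization_error (f i)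
    (submxcol (x k) i) (submxcol (x k.+1 - x k) i).
Proof.
move=> f2; have fd i z : differentiable (f i) z by case: (f2 i).
rewrite /dqm_error !grad_aggregate // hess_aggregate //.
rewrite -[x k.+1 - x k]submxcolK mul_mxdiag_mxcol -mxcolD -mxcolB.
apply: eq_mxcol => i; rewrite mxcolK /linearization_error submxcolB.
by rewrite [_ + (_ - _)]addrC subrK.
Qed.

Lemma sqr_enorm_blocks (v : 'bV[R]_(n, p)) :
  enorm v ^+ 2 = \sum_(i < n) enorm (submxcol v i) ^+ 2.
Proof.
by rewrite sqr_enorm dot_blocks; apply: eq_bigr => i _; rewrite sqr_enorm.
Qed.

End BlockVectors.

(** Each term is at most the whole sum. With a_i = (L/2) |v_i|^2 this recombines the blocks without
    a factor depending on n. *)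
Lemma sum_sqr_le_sqr_sum {R : realDomainType} (I : finType) (a : I -> R) :
  (forall i, 0 <= a i) -> \sum_i a i ^+ 2 <= (\sum_i a i) ^+ 2.
Proof.
move=> a0; rewrite expr2 mulr_suml; apply: ler_sum => i _.
rewrite expr2 ler_wpM2l // (bigD1 i) //= lerDl.
exact: sumr_ge0.
Qed.


Theorem proposition2 (R : realType) (n p : nat) (E : {set 'I_n * 'I_n})
    (E_sym : forall i j : 'I_n, ((i, j) \in E) = ((j, i) \in E))
    (E_connected : forall i j : 'I_n, connect (fun u v => (u, v) \in E) i j)
    (f : 'I_n -> 'cV[R]_p -> R) (c : R) (c_gt0 : 0 < c)
    (x : nat -> 'bV[R]_(n, p)) (z alpha beta : nat -> 'bV[R]_(#|E|, p))
    (dqm : dqm_recursion f c x z alpha beta)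
    (init_dual : alpha 0%N = - beta 0%N)
    (init_z : unoriented_incidence p E *m x 0%N = 2 *: z 0%N)
    (init_col : exists w : 'bV[R]_(n, p),
       alpha 0%N = oriented_incidence p E *m w)
    (gamma_u Gamma_u gamma_o : R)
    (gamma_u_gt0 : 0 < gamma_u)
    (sv_u : forall s : R, singular_value (unoriented_incidence p E) s ->
       gamma_u <= s <= Gamma_u)
    (gamma_o_gt0 : 0 < gamma_o)
    (gamma_o_sv : singular_value (oriented_incidence p E) gamma_o)
    (gamma_o_min : forall s : R, singular_value (oriented_incidence p E) s ->
       s != 0 -> gamma_o <= s)
    (m M : R) (m_gt0 : 0 < m) (le_mM : m <= M)
    (f_diff : forall i, twice_differentiable (f i))
    (f_hess : forall i y, loewner_le m%:M (hess (f i) y)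
                       /\ loewner_le (hess (f i) y) M%:M)
    (L : R)
    (f_lip : forall i y yhat,
       spectral_norm (hess (f i) y - hess (f i) yhat) <= L * enorm (y - yhat)) :
  forall k : nat,
    enorm (dqm_error f x k)
      <= Num.min (2 * M * enorm (x k.+1 - x k))
                 (L / 2 * enorm (x k.+1 - x k) ^+ 2).
Proof.
move=> k; rewrite le_min (dqm_error_blocks x k f_diff).
set v := x k.+1 - x k; set e := mxcol _.
have e_block i : submxcol e i =
  linearization_error (f i) (submxcol (x k) i) (submxcol v i) by rewrite mxcolK.
have M0 : 0 <= M := le_trans (ltW m_gt0) le_mM.
have bound1 i := linearization_error_bounded (submxcol (x k) i)
  (submxcol v i) (ltW m_gt0) (f_diff i) (f_hess i).
have bound2 i := linearization_error_lipschitz (submxcol (x k) i)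
  (submxcol v i) (f_diff i) (f_lip i).
apply/andP; split.
  (* The blocks yield the sharper constant M, then weakened to 2M. *)
  apply: (@le_trans _ _ (M * enorm v)); last first.
    by rewrite ler_wpM2r ?enorm_ge0 // ler_peMl // ler1n.
  rewrite -ler_sqr ?nnegrE ?mulr_ge0 ?enorm_ge0 //.
  rewrite exprMn !sqr_enorm_blocks mulr_sumr; apply: ler_sum => i _.
  by rewrite e_block -exprMn ler_sqr ?nnegrE ?mulr_ge0 ?enorm_ge0.
(* Again no sign of L is available; each block bound dominates a norm. *)
have a0 i : 0 <= L / 2 * enorm (submxcol v i) ^+ 2.
  exact: le_trans (enorm_ge0 _) (bound2 i).
rewrite -ler_sqr ?nnegrE ?enorm_ge0 // !sqr_enorm_blocks mulr_sumr ?sumr_ge0 //.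
apply: le_trans (sum_sqr_le_sqr_sum a0); apply: ler_sum => i _.
by rewrite e_block ler_sqr ?nnegrE ?enorm_ge0.
Qed.
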